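(* Assume $H_{ii}\succ0$ for $i=1,2,\dots,n$. If RPBCD (described in the context) is used to solve the unconstrained quadratic programming problem $$\min_{x\in\mathbb{R}^d}\ \tfrac12x^\top Hx+g^\top x,$$ then the expected iterative sequence $\{\mathbb{E}[x^k]\}$ converges to an optimal solution of this problem.
   Context: Setting: $x=(x_1,\dots,x_n)$ with $x_i\in\mathbb{R}^{d_i}$, $d=d_1+\dots+d_n$; $H\in\mathbb{R}^{d\times d}$ is symmetric positive semidefinite, partitioned into blocks $H_{ij}\in\mathbb{R}^{d_i\times d_j}$; $g\in\mathbb{R}^d$. The problem is assumed to have an optimal solution, i.e. $H\bar x+g=0$ for some $\bar x$. $\succ0$ means positive definite. RPBCD (randomly permuted block coordinate descent): start from a deterministic $x^0$. At each iteration $k\ge0$, a permutation $\sigma$ of $\{1,\dots,n\}$ is drawn uniformly at random, independently of the past. Then, for $j=1,\dots,n$ in order, $x_{\sigma(j)}^{k+1}$ is defined as the minimizer over $x_{\sigma(j)}\in\mathbb{R}^{d_{\sigma(j)}}$ of the objective with blocks $\sigma(1),\dots,\sigma(j-1)$ fixed at their new values $x^{k+1}_{\sigma(1)},\dots,x^{k+1}_{\sigma(j-1)}$ and blocks $\sigma(j+1),\dots,\sigma(n)$ fixed at their old values $x^k_{\sigma(j+1)},\dots,x^k_{\sigma(n)}$. The expectation $\mathbb{E}$ is over all random permutations drawn. *)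

(* Defs.v *)
From HB Require Import structures.
From mathcomp Require Import all_boot all_order all_algebra all_fingroup finmap.
From mathcomp Require Import all_classical all_reals all_analysis.

Set Implicit Arguments.
Unset Strict Implicit.
Unset Printing Implicit Defensive.

Import Order.TTheory GRing.Theory Num.Theory.
Import numFieldNormedType.Exports.

Local Open Scope classical_set_scope.
Local Open Scope ring_scope.

Definition psdmx (R : realType) (m : nat) (A : 'M[R]_m) : Prop :=
  A^T = A /\ forall v : 'cV[R]_m, 0 <= (v^T *m A *m v) 0 0.

Definition posdefmx (R : realType) (m : nat) (A : 'M[R]_m) : Prop :=
  A^T = A /\ forall v : 'cV[R]_m, v != 0 -> 0 < (v^T *m A *m v) 0 0.

Definition minimizer (R : realType) (V : Type) (f : V -> R) (v : V) : Prop :=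
  forall w : V, f v <= f w.

Definition qobj (R : realType) (m : nat) (H : 'M[R]_m) (g x : 'cV[R]_m) : R :=
  2^-1 * (x^T *m H *m x) 0 0 + (g^T *m x) 0 0.

(* The point at which the objective is evaluated in the [j]-th substep of a
   sweep in the order [s 0, s 1, ...] from [x] to [y]: block [s j] is [z], the
   blocks [s l] with [l < j] come from [y], those with [l > j] from [x]. *)
Definition bcd_point (R : realType) (n : nat) (p : 'I_n -> nat) (s : 'S_n)
    (x y : 'cV[R]_(\sum_i p i)) (j : 'I_n) (z : 'cV[R]_(p (s j))) :
    'cV[R]_(\sum_i p i) :=
  \mxcol_i dfwith
    (fun i => if ((s^-1)%g i < j)%N then submxcol y i else submxcol x i)
    (s j) z i.

Definition bcd_sweep (R : realType) (n : nat) (p : 'I_n -> nat)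
    (H : 'M[R]_(\sum_i p i)) (g : 'cV[R]_(\sum_i p i)) (s : 'S_n)
    (x y : 'cV[R]_(\sum_i p i)) : Prop :=
  forall j : 'I_n,
    minimizer (fun z : 'cV[R]_(p (s j)) => 
      qobj H g (bcd_point (s := s) (j := j) x y z))
      (submxcol y (s j)).

(* [U] carries the discrete sigma-algebra. *)
Definition discrete_rv (d : measure_display) (T : measurableType d) (U : Type)
    (X : T -> U) : Prop :=
  forall A : set U, measurable (X @^-1` A).

Definition mutually_independent (d : measure_display) (T : measurableType d)
    (R : realType) (P : probability T R) (U : Type) (X : nat -> T -> U) : Prop :=
  forall (J : {fset nat}) (A : nat -> set U),
    P (\bigcap_(k in [set` J]) (X k @^-1` A k)) =
    (\prod_(k <- J) P (X k @^-1` A k))%E.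

Definition uniform_rv (d : measure_display) (T : measurableType d)
    (R : realType) (P : probability T R) (U : finType) (X : T -> U) : Prop :=
  forall u : U, P (X @^-1` [set u]) = (#|U|%:R^-1)%:E.

Definition rpbcd (d : measure_display) (T : measurableType d) (R : realType)
    (P : probability T R) (n : nat) (p : 'I_n -> nat)
    (H : 'M[R]_(\sum_i p i)) (g x0 : 'cV[R]_(\sum_i p i))
    (sigma : nat -> T -> 'S_n) (x : nat -> T -> 'cV[R]_(\sum_i p i)) : Prop :=
  [/\ forall k, discrete_rv (sigma k),
      forall k, uniform_rv P (sigma k),
      mutually_independent P sigma,
      forall w, x 0%N w = x0 &
      forall k w, bcd_sweep H g (sigma k w) (x k w) (x k.+1 w)].

Definition integrable_cV (d : measure_display) (T : measurableType d)
    (R : realType) (P : probability T R) (m : nat) (X : T -> 'cV[R]_m) : Prop :=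
  forall i, P.-integrable setT (EFin \o (fun w => X w i 0)).

(* Meaningful only under [integrable_cV P X], because of [fine]. *)
Definition expectation_cV (d : measure_display) (T : measurableType d)
    (R : realType) (P : probability T R) (m : nat) (X : T -> 'cV[R]_m) :
    'cV[R]_m :=
  \col_i fine 'E_P[(fun w => X w i 0)%R]%E.

(* Main.v *)
Require Import Defs.
From HB Require Import structures.
From mathcomp Require Import all_boot all_order all_algebra all_fingroup finmap.
From mathcomp Require Import all_classical all_reals all_analysis.
From mathcomp Require Import ring lra.

Set Implicit Arguments.
Unset Strict Implicit.
Unset Printing Implicit Defensive.

Import Order.TTheory GRing.Theory Num.Theory.
Import numFieldNormedType.Exports.

Local Open Scope classical_set_scope.
Local Open Scope ring_scope.

(** Convergence already holds along every trajectory, at a geometric rate that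
    depends neither on the trajectory nor on the permutations drawn; the
    expectations inherit it.

    Let f be the objective and m its minimum. In a sweep from x to y, each
    substep makes the gradient vanish on one block i, so f drops by exactly
    half the quadratic form of H_ii at the change of that block. As H_ii is
    positive definite, |y - x|^2 <= C (f x - f y) ([sweep_step_le_decrease]).
    When a block is updated its gradient is zero, and the current point is
    within |y - x| of x, so the gradient at x satisfies |H x + g| <= C |y - x|
    ([sweep_gradient_le_step]). Finally f x - m <= C |H x + g|^2, even for
    singular H ([qobj_gap_le_gradient]). Chaining the three estimates,
    f x - m <= C (f x - f y), which means that f y - m <= q (f x - m) with
    q < 1 ([sweep_contraction]). All norms are max norms and C changes from one
    estimate to the next.

    Consequently |x^(k+1) - x^k| and |H x^k + g| are at most K r^k surely, for
    some constants K and r < 1 ([bcd_path_estimate]). Integrating, E[x^k] has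
    increments bounded by K r^k, hence converges, and H E[x^k] + g tends to 0,
    so the limit is stationary, that is, a minimizer. Integrability of x^k comes
    from the uniform bound and from measurability: a sweep has only one
    possible outcome ([bcd_sweep_unique]), so x^k is a function of the finitely
    valued permutations drawn so far. *)

(** * Max norm of matrices *)

Lemma mx_norm_ge_entry (R : realType) (m n : nat) (A : 'M[R]_(m, n)) i j :
  `|A i j| <= `|A|.
Proof.
rewrite [leRHS]/Num.norm /= mx_normrE.
by apply: (le_bigmax _ (fun ij => `|A ij.1 ij.2|) (i, j)).
Qed.

Lemma mx_norm_le (R : realType) (m n : nat) (A : 'M[R]_(m, n)) (c : R) :
  0 <= c -> (forall i j, `|A i j| <= c) -> `|A| <= c.
Proof.
move=> c0 Ac; rewrite [leLHS]/Num.norm /= mx_normrE.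
by apply/bigmax_leP; split => // -[i j] _; exact: Ac.
Qed.

Lemma mx_norm_sqr_le (R : realType) (m n : nat) (A : 'M[R]_(m, n)) (c : R) :
  0 <= c -> (forall i j, A i j ^+ 2 <= c) -> `|A| ^+ 2 <= c.
Proof.
move=> c0 Ac; have [->|/mx_norm_neq0 [[i j] /= Aij]] := eqVneq `|A| 0.
  by rewrite expr0n.
by rewrite /Num.norm /= Aij real_normK ?num_real.
Qed.

Lemma mx_norm_mul (R : realType) (m n p : nat)
    (A : 'M[R]_(m, n)) (B : 'M[R]_(n, p)) :
  `|A *m B| <= n%:R * `|A| * `|B|.
Proof.
apply: mx_norm_le => [|i j]; first by rewrite !mulr_ge0.
rewrite mxE; apply: le_trans (ler_norm_sum _ _ _) _.
apply: le_trans (_ : \sum_(k < n) `|A| * `|B| <= _).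
  by apply: ler_sum => k _; rewrite normrM ler_pM// mx_norm_ge_entry.
by rewrite sumr_const card_ord -mulrA mulr_natl.
Qed.

Lemma mx_norm_tr (R : realType) (m n : nat) (A : 'M[R]_(m, n)) :
  `|A^T| = `|A|.
Proof.
have tr_le p q (B : 'M[R]_(p, q)) : `|B^T| <= `|B|.
  by apply: mx_norm_le => // i j; rewrite mxE mx_norm_ge_entry.
by apply/eqP; rewrite eq_le tr_le -[X in `|X| <= _]trmxK tr_le.
Qed.

(** * Positive semidefinite forms *)

(** Near 0 the linear term of a quadratic dominates, so a nonzero [b] would give
    a negative value at a small [t] of the opposite sign. *)
Lemma quad_ge0_linear_eq0 (R : realType) (a b : R) :
  (forall t, 0 <= t * b + t ^+ 2 * a) -> b = 0.
Proof.
move=> quad_ge0; set c := `|a| + 1.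
have c0 : 0 < c by rewrite ltr_wpDl.
have ac : a < c by rewrite (le_lt_trans (ler_norm a))// ltrDl.
(* Evaluating at [- e] gives [e ^+ 2 * (a - 2 * c) >= 0], while [a < c]. *)
have [e be] : exists e, b = 2 * c * e.
  by exists (b / (2 * c)); field; rewrite gt_eqF.
have := quad_ge0 (- e); rewrite be => H.
have e2 : e ^+ 2 <= 0 by nra.
have : e ^+ 2 = 0 by apply/eqP; rewrite eq_le e2 sqr_ge0.
by move/eqP; rewrite sqrf_eq0 => /eqP ->; rewrite mulr0.
Qed.

Lemma bilin_sym (R : realType) (m : nat) (A : 'M[R]_m) (u v : 'cV[R]_m) :
  A^T = A -> (u^T *m A *m v) 0 0 = (v^T *m A *m u) 0 0.
Proof.
move=> symA; have -> : u^T *m A *m v = (v^T *m A *m u)^T.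
  by rewrite !trmx_mul trmxK symA mulmxA.
by rewrite mxE.
Qed.

Lemma trmx_scale (R : realType) (m n : nat) (t : R) (A : 'M[R]_(m, n)) :
  (t *: A)^T = t *: A^T.
Proof. by apply/matrixP => i j; rewrite !mxE. Qed.

Lemma mx11D (R : realType) (A B : 'M[R]_1) :
  (A + B) 0 0 = A 0 0 + B 0 0.
Proof. by rewrite mxE. Qed.

Lemma mx11Z (R : realType) (t : R) (A : 'M[R]_1) :
  (t *: A) 0 0 = t * A 0 0.
Proof. by rewrite mxE. Qed.

Lemma psd_cauchy_schwarz (R : realType) (m : nat) (A : 'M[R]_m)
    (u v : 'cV[R]_m) : psdmx A ->
  (u^T *m A *m v) 0 0 ^+ 2 <= (u^T *m A *m u) 0 0 * (v^T *m A *m v) 0 0.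
Proof.
move=> [symA psdA].
set a := (v^T *m A *m v) 0 0; set b := (u^T *m A *m v) 0 0.
set c := (u^T *m A *m u) 0 0.
have quad t : 0 <= c + 2 * t * b + t ^+ 2 * a.
  have := psdA (u + t *: v).
  rewrite [(_ + _)^T]linearD /= trmx_scale !mulmxDl !mulmxDr.
  rewrite -!scalemxAl -!scalemxAr.
  rewrite !(mx11D, mx11Z) -/a -/b -/c (bilin_sym v u symA) -/b; lra.
have a0 : 0 <= a by exact: psdA.
have c0 : 0 <= c by exact: psdA.
have [a_eq0|a_neq0] := eqVneq a 0.
  suff -> : b = 0 by rewrite expr0n mulr_ge0.
  have quadN t : 0 <= c + 2 * t * b by have := quad t; rewrite a_eq0; lra.
  (* An affine function of [t] with nonzero slope takes the value -1. *)
  apply/eqP/negPn/negP => bn0; have := quadN (- (c + 1) / (2 * b)).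
  have -> : 2 * (- (c + 1) / (2 * b)) * b = - (c + 1) by field.
  lra.
(* [- b / a] minimizes the quadratic in [t]. *)
have := quad (- b / a).
have -> : c + 2 * (- b / a) * b + (- b / a) ^+ 2 * a = (c * a - b ^+ 2) / a.
  by field.
by rewrite pmulr_lge0 ?subr_ge0// invr_gt0 lt_def a_neq0.
Qed.

Lemma posdef_psd (R : realType) (m : nat) (A : 'M[R]_m) :
  posdefmx A -> psdmx A.
Proof.
move=> [symA posA]; split=> // v.
have [->|/posA/ltW//] := eqVneq v 0.
by rewrite mulmx0 mxE.
Qed.

Lemma posdef_unitmx (R : realType) (m : nat) (A : 'M[R]_m) :
  posdefmx A -> A \in unitmx.
Proof.
move=> [symA posA]; rewrite -row_free_unit -kermx_eq0.
apply/rowV0P => v /sub_kermxP vA0; apply/eqP/negPn/negP => v0.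
have vT0 : v^T != 0 by rewrite -trmx0 (inj_eq trmx_inj).
by have := posA _ vT0; rewrite trmxK vA0 mul0mx mxE ltxx.
Qed.

(** A coordinate of [v] is the [A]-inner product of [v] with a column of the
    inverse of [A], so Cauchy-Schwarz for the form [A] bounds it by the energy of
    [v]; the constant is the trace of the inverse. *)
Lemma posdef_coercive (R : realType) (m : nat) (A : 'M[R]_m) :
  posdefmx A -> exists2 c, 0 <= c &
    forall v : 'cV[R]_m, `|v| ^+ 2 <= c * (v^T *m A *m v) 0 0.
Proof.
move=> posA; have [symA psdA] := posdef_psd posA.
pose u (i : 'I_m) : 'cV[R]_m := invmx A *m delta_mx i 0.
pose q (w : 'cV[R]_m) := (w^T *m A *m w) 0 0.
exists (\sum_i q (u i)) => [|v]; first by apply: sumr_ge0 => i _; exact: psdA.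
apply: mx_norm_sqr_le => [|i j].
  by apply: mulr_ge0 => //; apply: sumr_ge0 => i _; exact: psdA.
rewrite ord1.
have -> : v i 0 = ((u i)^T *m A *m v) 0 0.
  rewrite trmx_mul trmx_inv symA -(mulmxA _ (invmx A)) mulVmx ?posdef_unitmx//.
  by rewrite mulmx1 trmx_delta -rowE mxE.
apply: le_trans (psd_cauchy_schwarz _ _ (posdef_psd posA)) _.
apply: ler_wpM2r; first exact: psdA.
by rewrite (bigD1 i)//= lerDl; apply: sumr_ge0 => k _; exact: psdA.
Qed.

(** * Quadratic objectives *)

Lemma qobjD (R : realType) (m : nat) (H : 'M[R]_m) (g u w : 'cV[R]_m) :
  H^T = H -> qobj H g (u + w) =
    qobj H g u + (w^T *m (H *m u + g)) 0 0 + 2^-1 * (w^T *m H *m w) 0 0.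
Proof.
move=> symH; rewrite /qobj [(_ + _)^T]linearD /= !mulmxDl !mulmxDr !mulmxA.
rewrite !mx11D (bilin_sym u w symH).
have -> : w^T *m g = (g^T *m w)^T by rewrite trmx_mul trmxK.
rewrite [(_^T) 0 0]mxE; lra.
Qed.

Lemma qobj_stationary_dir (R : realType) (m : nat) (H : 'M[R]_m)
    (g u w : 'cV[R]_m) :
  H^T = H -> (forall t : R, qobj H g u <= qobj H g (u + t *: w)) ->
  (w^T *m (H *m u + g)) 0 0 = 0.
Proof.
move=> symH min_u.
apply: (@quad_ge0_linear_eq0 _ (2^-1 * (w^T *m H *m w) 0 0)) => t.
have := min_u t; rewrite qobjD// trmx_scale -!scalemxAl -!scalemxAr.
rewrite !mx11Z; lra.
Qed.

Lemma qobj_minimizerP (R : realType) (m : nat) (H : 'M[R]_m) (g u : 'cV[R]_m) :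
  psdmx H -> minimizer (qobj H g) u <-> H *m u + g = 0.
Proof.
move=> [symH psdH]; split=> [min_u|grad0 w].
  apply/matrixP => i j; rewrite ord1 [RHS]mxE.
  have := @qobj_stationary_dir _ _ H g u (delta_mx i 0) symH.
  by rewrite trmx_delta -rowE [(row _ _) _ _]mxE => ->.
rewrite -[w in leRHS](subrKC u) qobjD// grad0 mulmx0 mxE addr0 lerDl.
by rewrite mulr_ge0.
Qed.

(** With [e = u - xbar] the gradient is [h = H e] and the gap is half of
    [e^T H e]. For a generalized inverse [P], i.e. [H P H = H], this is half of
    [h^T P h], a quadratic form in the gradient alone; no positive lower bound
    on the spectrum of [H] has to be extracted. *)
Lemma qobj_gap_le_gradient (R : realType) (m : nat) (H : 'M[R]_m)
    (g xbar : 'cV[R]_m) : H^T = H -> H *m xbar + g = 0 ->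
  exists2 c, 0 <= c &
    forall u, qobj H g u - qobj H g xbar <= c * `|H *m u + g| ^+ 2.
Proof.
move=> symH grad0.
have [P HPH] : exists P : 'M[R]_m, H *m (P *m H) = H.
  by exists (pinvmx H); rewrite mulmxA mulmxKpV.
exists (m%:R * (m%:R * `|P|)) => [|u]; first by rewrite !mulr_ge0.
pose e := u - xbar; pose h := H *m u + g.
have hE : h = H *m e by rewrite mulmxBr (addr0_eq grad0).
rewrite -[u in leLHS](subrKC xbar) qobjD// grad0 mulmx0 mxE addr0 addrC addKr.
rewrite -/e.
have -> : e^T *m H *m e = h^T *m (P *m h).
  rewrite hE trmx_mul symH !mulmxA; congr (_ *m _).
  by rewrite -!mulmxA HPH.
rewrite -/h.
have : `|(h^T *m (P *m h)) 0 0| <= m%:R * (m%:R * `|P|) * `|h| ^+ 2.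
  apply: le_trans (mx_norm_ge_entry _ _ _) _.
  apply: le_trans (mx_norm_mul _ _) _; rewrite mx_norm_tr expr2.
  rewrite (_ : _ * (`|h| * `|h|) = m%:R * `|h| * (m%:R * `|P| * `|h|)).
    by apply: ler_wpM2l; rewrite ?mulr_ge0 ?mx_norm_mul.
  by ring.
have := ler_norm ((h^T *m (P *m h)) 0 0).
have := normr_ge0 ((h^T *m (P *m h)) 0 0).
lra.
Qed.

(** * Partial sweeps and block coordinates *)

Definition sweep_prefix (R : realType) (n : nat) (p : 'I_n -> nat) (s : 'S_n)
    (x y : 'cV[R]_(\sum_i p i)) (c : nat) : 'cV[R]_(\sum_i p i) :=
  \mxcol_i (if ((s^-1)%g i < c)%N then submxcol y i else submxcol x i).

Definition block_embed (R : realType) (n : nat) (p : 'I_n -> nat) (i : 'I_n)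
    (z : 'cV[R]_(p i)) : 'cV[R]_(\sum_i p i) :=
  \mxcol_k dfwith (fun k => 0 : 'cV[R]_(p k)) i z k.

Lemma submxcol_entry (R : realType) (n : nat) (p : 'I_n -> nat)
    (v : 'cV[R]_(\sum_i p i)) (k : 'I_(\sum_i p i)) (j : 'I_1) :
  v k j = submxcol v (tagnat.sig1 k) (tagnat.sig2 k) j.
Proof. by rewrite mxE tagnat.sig2K. Qed.

Lemma block_embedZ (R : realType) (n : nat) (p : 'I_n -> nat) (i : 'I_n)
    (t : R) (z : 'cV[R]_(p i)) :
  block_embed (t *: z) = t *: block_embed z.
Proof.
apply/mxcolP => k; rewrite mxcolK.
have -> : submxcol (t *: block_embed z) k = t *: submxcol (block_embed z) k.
  by apply/matrixP => a b; rewrite !mxE.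
rewrite mxcolK; have [<-|ik] := eqVneq i k; first by rewrite !dfwithin.
by rewrite !dfwithout// scaler0.
Qed.

Lemma tr_block_embed_mul (R : realType) (n : nat) (p : 'I_n -> nat) (i : 'I_n)
    (z : 'cV[R]_(p i)) (v : 'cV[R]_(\sum_i p i)) :
  (block_embed z)^T *m v = z^T *m submxcol v i.
Proof.
rewrite tr_mxcol -[v in LHS]submxcolK mul_mxrow_mxcol (bigD1 i)//=.
rewrite dfwithin big1 ?addr0// => k ki.
by rewrite dfwithout 1?eq_sym// trmx0 mul0mx.
Qed.

Lemma block_embed_quad (R : realType) (n : nat) (p : 'I_n -> nat) (i : 'I_n)
    (H : 'M[R]_(\sum_i p i)) (z : 'cV[R]_(p i)) :
  (block_embed z)^T *m H *m block_embed z = z^T *m submxblock H i i *m z.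
Proof.
rewrite -mulmxA tr_block_embed_mul -mulmxA; congr (_ *m _).
rewrite -submxcol_mul -[submxcol H i]submxrowK mul_mxrow_mxcol (bigD1 i)//=.
rewrite dfwithin -submxblockEv big1 ?addr0// => k ki.
by rewrite dfwithout 1?eq_sym// mulmx0.
Qed.

Lemma sweep_prefixS (R : realType) (n : nat) (p : 'I_n -> nat) (s : 'S_n)
    (x y : 'cV[R]_(\sum_i p i)) (j : 'I_n) :
  sweep_prefix s x y j.+1 =
    sweep_prefix s x y j + block_embed (submxcol (y - x) (s j)).
Proof.
apply/mxcolP => i; rewrite [RHS]submxcolD !mxcolK ltnS.
have [<-|sji] := eqVneq (s j) i.
  by rewrite dfwithin permK leqnn ltnn submxcolB subrKC.
rewrite dfwithout// addr0 leq_eqVlt; case: eqP => // /val_inj ji.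
by rewrite -ji permKV eqxx in sji.
Qed.

Lemma sweep_prefix0 (R : realType) (n : nat) (p : 'I_n -> nat) (s : 'S_n)
    (x y : 'cV[R]_(\sum_i p i)) : sweep_prefix s x y 0 = x.
Proof. by apply/mxcolP => i; rewrite mxcolK. Qed.

Lemma sweep_prefix_full (R : realType) (n : nat) (p : 'I_n -> nat) (s : 'S_n)
    (x y : 'cV[R]_(\sum_i p i)) (c : nat) :
  (n <= c)%N -> sweep_prefix s x y c = y.
Proof.
by move=> nc; apply/mxcolP => i; rewrite mxcolK (leq_trans (ltn_ord _) nc).
Qed.

Lemma sweep_prefixB (R : realType) (n : nat) (p : 'I_n -> nat) (s : 'S_n)
    (x y x' y' : 'cV[R]_(\sum_i p i)) (c : nat) :
  sweep_prefix s x y c - sweep_prefix s x' y' c =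
    sweep_prefix s (x - x') (y - y') c.
Proof.
by apply/mxcolP => i; rewrite submxcolB !mxcolK !submxcolB; case: ifP.
Qed.

(** Each block of the partially updated point is a block of [x] or of [y]. *)
Lemma sweep_prefix_dist (R : realType) (n : nat) (p : 'I_n -> nat) (s : 'S_n)
    (x y : 'cV[R]_(\sum_i p i)) (c : nat) :
  `|x - sweep_prefix s x y c| <= `|y - x|.
Proof.
rewrite [leRHS]distrC -[x in leLHS](sweep_prefix_full s x x (leq_maxr c n)).
apply: mx_norm_le => // k j.
rewrite sweep_prefix_full ?leq_maxr// submxcol_entry submxcolB mxcolK.
case: ifP => _; last by rewrite subrr mxE normr0.
by rewrite -submxcolB -submxcol_entry mx_norm_ge_entry.
Qed.

Lemma bcd_point_prefix (R : realType) (n : nat) (p : 'I_n -> nat) (s : 'S_n)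
    (x y : 'cV[R]_(\sum_i p i)) (j : 'I_n) (z : 'cV[R]_(p (s j))) :
  bcd_point x y z =
    sweep_prefix s x y j.+1 + block_embed (z - submxcol y (s j)).
Proof.
apply/mxcolP => i; rewrite [RHS]submxcolD !mxcolK ltnS.
have [<-|sji] := eqVneq (s j) i; first by rewrite permK leqnn !dfwithin subrKC.
rewrite !dfwithout// addr0 [in RHS]leq_eqVlt; case: eqP => // /val_inj ji.
by rewrite -ji permKV eqxx in sji.
Qed.

(** First-order form of [bcd_sweep]. The condition is affine in [(x, y)], so the
    difference of two sweeps in the same order is a sweep for [g = 0]. *)
Definition sweep_stationary (R : realType) (n : nat) (p : 'I_n -> nat)
    (H : 'M[R]_(\sum_i p i)) (g : 'cV[R]_(\sum_i p i)) (s : 'S_n)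
    (x y : 'cV[R]_(\sum_i p i)) : Prop :=
  forall j : 'I_n, submxcol (H *m sweep_prefix s x y j.+1 + g) (s j) = 0.

(** * Linear convergence of block coordinate descent for any orders *)

Lemma bcd_sweep_stationary (R : realType) (n : nat) (p : 'I_n -> nat)
    (H : 'M[R]_(\sum_i p i)) (g : 'cV[R]_(\sum_i p i)) (s : 'S_n)
    (x y : 'cV[R]_(\sum_i p i)) :
  H^T = H -> bcd_sweep H g s x y -> sweep_stationary H g s x y.
Proof.
move=> symH sweep j; set u := sweep_prefix s x y j.+1.
apply/matrixP => a b; rewrite ord1 [RHS]mxE.
pose w := block_embed (delta_mx a 0 : 'cV[R]_(p (s j))).
have : (w^T *m (H *m u + g)) 0 0 = 0.
  apply: qobj_stationary_dir => // t; rewrite -block_embedZ.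
  have := sweep j (submxcol y (s j) + t *: delta_mx a 0).
  rewrite !bcd_point_prefix [in X in _ <= X]addrAC !subrr add0r.
  have -> : block_embed (0 : 'cV[R]_(p (s j))) = 0.
    by rewrite -(scale0r 0) block_embedZ scale0r.
  by rewrite addr0.
by rewrite tr_block_embed_mul trmx_delta -rowE [(row _ _) _ _]mxE.
Qed.

(** Expand the objective around the point after the substep: the linear term is
    the gradient on the updated block, which vanishes there. *)
Lemma substep_decrease (R : realType) (n : nat) (p : 'I_n -> nat)
    (H : 'M[R]_(\sum_i p i)) (g : 'cV[R]_(\sum_i p i)) (s : 'S_n)
    (x y : 'cV[R]_(\sum_i p i)) (j : 'I_n) (z := submxcol (y - x) (s j)) :
  H^T = H -> sweep_stationary H g s x y ->
  qobj H g (sweep_prefix s x y j) =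
    qobj H g (sweep_prefix s x y j.+1) +
    2^-1 * (z^T *m submxblock H (s j) (s j) *m z) 0 0.
Proof.
move=> symH stat.
have -> : sweep_prefix s x y j =
    sweep_prefix s x y j.+1 + block_embed (- 1 *: z).
  by rewrite block_embedZ scaleN1r sweep_prefixS addrK.
rewrite qobjD// tr_block_embed_mul stat mulmx0 mxE addr0 block_embed_quad.
by rewrite trmx_scale -scalemxAl -scalemxAl -scalemxAr !scaleN1r opprK.
Qed.

Lemma block_coercive (R : realType) (n : nat) (p : 'I_n -> nat)
    (H : 'M[R]_(\sum_i p i)) : (forall i, posdefmx (submxblock H i i)) ->
  exists2 c, 0 <= c & forall i (z : 'cV[R]_(p i)),
    `|z| ^+ 2 <= c * (z^T *m submxblock H i i *m z) 0 0.
Proof.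
move=> H_diag.
have coer i : exists c, 0 <= c /\ forall z : 'cV[R]_(p i),
    `|z| ^+ 2 <= c * (z^T *m submxblock H i i *m z) 0 0.
  by have [c c0 cP] := posdef_coercive (H_diag i); exists c.
have [c cP] := fin_all_exists coer.
exists (\sum_i c i) => [|i z]; first by apply: sumr_ge0 => i _; case: (cP i).
have [ci0 ciP] := cP i; apply: le_trans (ciP z) _; apply: ler_wpM2r.
  by have [_] := posdef_psd (H_diag i).
by rewrite (bigD1 i)//= lerDl; apply: sumr_ge0 => k _; case: (cP k).
Qed.

(** Every substep decreases the objective, so the drop in the substep that moves
    a given block is at most the total drop over the sweep. The constant is
    strictly positive so that the right-hand side, being nonnegative, forces
    descent. *)
Lemma sweep_step_le_decrease (R : realType) (n : nat) (p : 'I_n -> nat)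
    (H : 'M[R]_(\sum_i p i)) : H^T = H ->
  (forall i, posdefmx (submxblock H i i)) ->
  exists2 c, 0 < c & forall g s (x y : 'cV[R]_(\sum_i p i)),
    sweep_stationary H g s x y ->
    `|y - x| ^+ 2 <= c * (qobj H g x - qobj H g y).
Proof.
move=> symH H_diag; have [c c0 cP] := block_coercive H_diag.
exists (1 + 2 * c) => [|g s x y stat]; first by rewrite ltr_pwDl ?mulr_ge0.
pose f k := qobj H g (sweep_prefix s x y k).
have f_noninc : {homo f : k l / (k <= l)%N >-> l <= k}.
  apply/nonincreasing_seqP => k; rewrite /f; have [kn|nk] := ltnP k n.
    rewrite (substep_decrease (Ordinal kn) symH stat) lerDl.
    by apply: mulr_ge0 => //; have [_] := posdef_psd (H_diag (s (Ordinal kn))).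
  by rewrite !sweep_prefix_full// (leq_trans nk).
have f0 : f 0%N = qobj H g x by rewrite /f sweep_prefix0.
have fn : f n = qobj H g y by rewrite /f sweep_prefix_full.
have decr : 0 <= qobj H g x - qobj H g y by rewrite -f0 -fn subr_ge0 f_noninc.
have block_le (j : 'I_n) :
    `|submxcol (y - x) (s j)| ^+ 2 <= 2 * c * (qobj H g x - qobj H g y).
  apply: le_trans (cP _ _) _; rewrite -f0 -fn.
  have := f_noninc _ _ (leq0n j); have := f_noninc _ _ (ltn_ord j).
  have := substep_decrease j symH stat; rewrite -/(f j) -/(f j.+1).
  move=> fj fnj fj0.
  by rewrite [2 * c]mulrC -mulrA; apply: ler_wpM2l => //; lra.
apply: le_trans (_ : 2 * c * (qobj H g x - qobj H g y) <= _); last first.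
  by rewrite ler_wpM2r// lerDr.
apply: mx_norm_sqr_le => [|k b]; first by rewrite !mulr_ge0.
have := block_le ((s^-1)%g (tagnat.sig1 k)); rewrite permKV => block_k.
apply: le_trans block_k.
by rewrite submxcol_entry -[leLHS]real_normK ?num_real// lerXn2r// ?nnegrE//
  mx_norm_ge_entry.
Qed.

(** On each block, compare the gradient at [x] with the gradient just after this
    block has been updated, where it is zero. *)
Lemma sweep_gradient_le_step (R : realType) (n : nat) (p : 'I_n -> nat)
    (H : 'M[R]_(\sum_i p i)) (g : 'cV[R]_(\sum_i p i)) (s : 'S_n)
    (x y : 'cV[R]_(\sum_i p i)) :
  sweep_stationary H g s x y ->
  `|H *m x + g| <= (\sum_i p i)%N%:R * `|H| * `|y - x|.
Proof.
move=> stat; apply: mx_norm_le => [|k b]; first by rewrite !mulr_ge0.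
pose j := (s^-1)%g (tagnat.sig1 k).
have grad_k : (H *m x + g) k b = (H *m (x - sweep_prefix s x y j.+1)) k b.
  have : (H *m sweep_prefix s x y j.+1 + g) k b = 0.
    have sj : s j = tagnat.sig1 k by rewrite permKV.
    by have := stat j; rewrite sj submxcol_entry => ->; rewrite mxE.
  by rewrite mulmxBr !mxE; lra.
rewrite grad_k; apply: le_trans (mx_norm_ge_entry _ _ _) _.
apply: le_trans (mx_norm_mul _ _) _.
by apply: ler_wpM2l; rewrite ?mulr_ge0// sweep_prefix_dist.
Qed.

(** The three estimates give [gap x <= D (gap x - gap y)], which rearranges to
    [gap y <= D / (1 + D) * gap x] since [gap y <= gap x]. *)
Lemma sweep_contraction (R : realType) (n : nat) (p : 'I_n -> nat)
    (H : 'M[R]_(\sum_i p i)) (g xbar : 'cV[R]_(\sum_i p i)) :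
  H^T = H -> H *m xbar + g = 0 ->
  (forall i, posdefmx (submxblock H i i)) ->
  exists q, [/\ 0 <= q, q < 1 & forall s x y, sweep_stationary H g s x y ->
    qobj H g y - qobj H g xbar <= q * (qobj H g x - qobj H g xbar)].
Proof.
move=> symH grad0 H_diag.
have [c c0 gap_le] := qobj_gap_le_gradient symH grad0.
have [e e_gt0 step_le] := sweep_step_le_decrease symH H_diag.
have [K K0 KE] : exists2 K, 0 <= K & K = (\sum_i p i)%N%:R * `|H|.
  by eexists; last reflexivity; rewrite mulr_ge0.
have e0 := ltW e_gt0.
pose D := c * K ^+ 2 * e.
have D0 : 0 <= D by rewrite !mulr_ge0 ?exprn_ge0.
exists (D / (1 + D)); split => [||s x y stat].
- by rewrite divr_ge0 ?addr_ge0.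
- by rewrite ltr_pdivrMr ?ltr_pwDl// mul1r ltrDr.
have step := step_le _ _ _ _ stat.
have gap : qobj H g x - qobj H g xbar <= D * (qobj H g x - qobj H g y).
  apply: le_trans (gap_le x) _; rewrite /D -!mulrA; apply: ler_wpM2l => //.
  apply: le_trans (_ : (K * `|y - x|) ^+ 2 <= _).
    by rewrite lerXn2r ?nnegrE ?mulr_ge0// KE (sweep_gradient_le_step stat).
  by rewrite exprMn expr2 -mulrA; do 2 apply: ler_wpM2l => //.
have descent : qobj H g y <= qobj H g x.
  by rewrite -subr_ge0 -(pmulr_rge0 _ e_gt0); apply: le_trans step.
rewrite mulrAC ler_pdivlMr ?ltr_pwDl//; lra.
Qed.

(** The difference of two outcomes is the outcome of a sweep from 0 for the
    homogeneous objective [g = 0]. That objective is nonnegative and vanishes at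
    0, so the sweep cannot decrease it, hence does not move. *)
Lemma bcd_sweep_unique (R : realType) (n : nat) (p : 'I_n -> nat)
    (H : 'M[R]_(\sum_i p i)) (g : 'cV[R]_(\sum_i p i)) (s : 'S_n)
    (x y y' : 'cV[R]_(\sum_i p i)) :
  psdmx H -> (forall i, posdefmx (submxblock H i i)) ->
  bcd_sweep H g s x y -> bcd_sweep H g s x y' -> y = y'.
Proof.
move=> [symH psdH] H_diag.
move=> /(bcd_sweep_stationary symH) stat /(bcd_sweep_stationary symH) stat'.
have [c c_gt0 step_le] := sweep_step_le_decrease symH H_diag.
have c0 := ltW c_gt0.
have statB : sweep_stationary H 0 s 0 (y - y').
  move=> j; rewrite addr0 -(subrr x) -sweep_prefixB mulmxBr.
  have -> (a b : 'cV[R]_(\sum_i p i)) : a - b = (a + g) - (b + g).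
    by rewrite opprD addrACA subrr addr0.
  by rewrite submxcolB stat stat' subrr.
have := step_le _ _ _ _ statB; rewrite subr0 /qobj.
rewrite trmx0 !mul0mx [(0 : matrix _ _ _) 0 0]mxE mulr0 !addr0 sub0r mulrN.
move=> B_le.
have energy_ge0 : 0 <= c * (2^-1 * ((y - y')^T *m H *m (y - y')) 0 0).
  by rewrite !mulr_ge0.
have /eqP : `|y - y'| ^+ 2 = 0.
  apply/eqP; rewrite eq_le sqr_ge0 andbT; apply: le_trans B_le _.
  by rewrite oppr_le0.
by rewrite sqrf_eq0 normr_eq0 subr_eq0 => /eqP.
Qed.

(** The rate is the square root of the contraction factor because the objective
    gap controls the square of the step. *)
Lemma bcd_path_estimate (R : realType) (n : nat) (p : 'I_n -> nat)
    (H : 'M[R]_(\sum_i p i)) (g x0 : 'cV[R]_(\sum_i p i)) :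
  psdmx H -> (exists xbar, minimizer (qobj H g) xbar) ->
  (forall i, posdefmx (submxblock H i i)) ->
  exists K r, [/\ 0 <= r, r < 1 &
    forall (s : nat -> 'S_n) (u : nat -> 'cV[R]_(\sum_i p i)), u 0%N = x0 ->
    (forall k, bcd_sweep H g (s k) (u k) (u k.+1)) ->
    forall k, `|u k.+1 - u k| <= K * r ^+ k /\ `|H *m u k + g| <= K * r ^+ k].
Proof.
move=> psdH [xbar min_xbar] H_diag; have symH := psdH.1.
have grad0 := (qobj_minimizerP g xbar psdH).1 min_xbar.
have [q [q0 q1 contr]] := sweep_contraction symH grad0 H_diag.
have [c c_gt0 step_le] := sweep_step_le_decrease symH H_diag.
have c0 := ltW c_gt0.
pose gap0 := qobj H g x0 - qobj H g xbar.
have gap0_ge0 : 0 <= gap0 by rewrite subr_ge0.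
pose L := Num.sqrt (c * gap0); pose M := (\sum_i p i)%N%:R * `|H|.
have M0 : 0 <= M by rewrite mulr_ge0.
exists ((1 + M) * L), (Num.sqrt q); split => [||s u u0 sweep k].
- exact: sqrtr_ge0.
- by rewrite -sqrtr1 ltr_sqrt.
have stat l := bcd_sweep_stationary symH (sweep l).
have gap l : qobj H g (u l) - qobj H g xbar <= q ^+ l * gap0.
  elim: l => [|l IHl]; first by rewrite u0 mul1r.
  apply: le_trans (contr _ _ _ (stat l)) _.
  by rewrite exprS -mulrA; apply: ler_wpM2l.
have step : `|u k.+1 - u k| <= L * Num.sqrt q ^+ k.
  rewrite -(@ler_pXn2r _ 2)// ?nnegrE ?mulr_ge0 ?exprn_ge0 ?sqrtr_ge0//.
  rewrite exprMn exprAC !sqr_sqrtr ?mulr_ge0//.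
  apply: le_trans (step_le _ _ _ _ (stat k)) _; rewrite -mulrA.
  apply: ler_wpM2l => //; rewrite [leRHS]mulrC; apply: le_trans (gap k).
  by rewrite lerB.
have Lq0 : 0 <= L * Num.sqrt q ^+ k by rewrite mulr_ge0 ?exprn_ge0 ?sqrtr_ge0.
rewrite -mulrA mulrDl mul1r; split.
  by apply: le_trans step _; rewrite lerDl mulr_ge0.
apply: le_trans (sweep_gradient_le_step (stat k)) _.
rewrite -/M; apply: le_trans (_ : M * (L * Num.sqrt q ^+ k) <= _).
  exact: ler_wpM2l.
by rewrite lerDr.
Qed.

(** * Convergence criteria for sequences *)

Lemma cvg_mx_entry (R : realType) (m n : nat) (u : nat -> 'M[R]_(m, n))
    (l : 'M[R]_(m, n)) :
  (forall i j, (fun k => u k i j) @ \oo --> l i j) -> u @ \oo --> l.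
Proof.
move=> entry_cvg; apply/cvg_ballP => e e0.
suff : \forall k \near \oo, forall ij, ball (l ij.1 ij.2) e (u k ij.1 ij.2).
  by apply: filterS => k ball_k; split => // i j; exact: (ball_k (i, j)).
apply: filter_forall => -[i j] /=.
by have /cvg_ballP/(_ e e0) := entry_cvg i j.
Qed.

Lemma cvg_geometric_increments (R : realType) (a : nat -> R) (K r : R) :
  0 <= r -> r < 1 -> (forall k, `|a k.+1 - a k| <= K * r ^+ k) ->
  cvgn a.
Proof.
move=> r0 r1 step.
have -> : a = (fun k => a 0%N + series (telescope a) k).
  by apply/funext => k; rewrite -eq_sum_telescope.
apply: is_cvgD; first exact: is_cvg_cst.
apply: normed_cvg; apply: (@series_le_cvg _ _ (geometric K r)) => [k|k|k|].
- exact: normr_ge0.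
- exact: le_trans (normr_ge0 _) (step k).
- exact: step.
- by apply: is_cvg_geometric_series; rewrite ger0_norm.
Qed.

(** * Iterates as random vectors *)

(** The event that the next iterate lies in [A] splits over the finitely many
    permutations. Given the permutation it is an event about the current iterate
    alone, because the outcome of a sweep is unique. *)
Lemma discrete_rv_iterates (R : realType) (n : nat) (p : 'I_n -> nat)
    (H : 'M[R]_(\sum_i p i)) (g x0 : 'cV[R]_(\sum_i p i))
    (d : measure_display) (T : measurableType d)
    (sigma : nat -> T -> 'S_n) (x : nat -> T -> 'cV[R]_(\sum_i p i)) :
  psdmx H -> (forall i, posdefmx (submxblock H i i)) ->
  (forall k, discrete_rv (sigma k)) -> (forall w, x 0%N w = x0) ->
  (forall k w, bcd_sweep H g (sigma k w) (x k w) (x k.+1 w)) ->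
  forall k, discrete_rv (x k).
Proof.
move=> psdH H_diag sigma_meas x_init sweep; elim=> [|k IHk] A.
  have -> : x 0%N = cst x0 by apply/funext => w; exact: x_init.
  by rewrite preimage_cst; case: ifP.
have -> : x k.+1 @^-1` A = \bigcup_(s in [set: 'S_n])
    (sigma k @^-1` [set s] `&`
     x k @^-1` [set v | exists2 y, A y & bcd_sweep H g s v y]).
  apply/seteqP; split => [w /= Aw|w [s _ /= [<- [y Ay sweep_y]]]].
    by exists (sigma k w) => //; split => //; exists (x k.+1 w).
  by rewrite (bcd_sweep_unique psdH H_diag (sweep k w) sweep_y).
apply: fin_bigcup_measurable => [|s _]; first exact: finite_finset.
apply: measurableI => //.
exact: sigma_meas.
Qed.

Lemma discrete_rv_integrable (R : realType) (m : nat) (d : measure_display)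
    (T : measurableType d) (P : probability T R) (X : T -> 'cV[R]_m) (M : R) :
  discrete_rv X -> (forall w, `|X w| <= M) -> integrable_cV P X.
Proof.
move=> X_meas X_le i; apply: measurable_bounded_integrable => //.
- by apply: le_lt_trans (probability_le1 P measurableT) _; rewrite ltry.
- by move=> _ Y _; rewrite setTI; exact: (X_meas [set v | Y (v i 0)]).
- exists M; split; first exact: num_real.
  move=> M' MM' w _; apply: le_trans (mx_norm_ge_entry _ _ _) _.
  exact: le_trans (X_le w) (ltW MM').
Qed.

Lemma Rintegral_probability_le (R : realType) (d : measure_display)
    (T : measurableType d) (P : probability T R) (f : T -> R) (c : R) :
  P.-integrable setT (EFin \o f) -> (forall w, `|f w| <= c) ->
  `|\int[P]_w f w| <= c.
Proof.
move=> f_int f_le; apply: le_trans (le_normr_Rintegral _ f_int) _ => //.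
have -> : c = \int[P]_w c.
  by rewrite Rintegral_cst// (congr1 fine (probability_setT P)) mulr1.
apply: le_Rintegral => //.
- exact: integrable_norm f_int.
- by apply/finite_measure_integrable_cst.
Qed.

Lemma Rintegral_lin_comb (R : realType) (d : measure_display)
    (T : measurableType d) (P : probability T R) (m : nat) (a : 'I_m -> R)
    (f : 'I_m -> T -> R) :
  (forall j, P.-integrable setT (EFin \o f j)) ->
  P.-integrable setT (EFin \o (fun w => \sum_j a j * f j w)) /\
  \int[P]_w (\sum_j a j * f j w) = \sum_j a j * \int[P]_w f j w.
Proof.
move=> f_int.
have af_int j : P.-integrable setT (fun w => (a j * f j w)%:E).
  by have := integrableZl measurableT (a j) (f_int j).
have sumE : EFin \o (fun w => \sum_j a j * f j w) =
    (fun w => \sum_j (a j * f j w)%:E)%E.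
  by apply/funext => w; rewrite /= sumEFin.
split; first by rewrite sumE; exact: integrable_sum.
rewrite /Rintegral -[X in fine (integral _ _ X)]/(EFin \o _) sumE.
rewrite integral_sum//.
rewrite (eq_bigr (fun j => (a j * \int[P]_w f j w)%:E)) ?sumEFin// => j _.
by rewrite -RintegralZl// /Rintegral fineK// integrable_fin_num.
Qed.

Lemma expectation_cV_le (R : realType) (m : nat) (d : measure_display)
    (T : measurableType d) (P : probability T R) (X : T -> 'cV[R]_m)
    (Y : T -> 'cV[R]_m) (c : R) (i : 'I_m) :
  integrable_cV P X -> integrable_cV P Y -> (forall w, `|Y w - X w| <= c) ->
  `|expectation_cV P Y i 0 - expectation_cV P X i 0| <= c.
Proof.
move=> X_int Y_int dist_le; rewrite !mxE unlock.
rewrite -/(Rintegral _ _ _) -/(Rintegral _ _ _) -RintegralB//.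
apply: Rintegral_probability_le => [|w].
  by have := integrableB measurableT (Y_int i) (X_int i).
by have := mx_norm_ge_entry (Y w - X w) i 0; rewrite !mxE => /le_trans; apply.
Qed.

Lemma expectation_cV_affine_le (R : realType) (m : nat) (d : measure_display)
    (T : measurableType d) (P : probability T R) (X : T -> 'cV[R]_m)
    (H : 'M[R]_m) (g : 'cV[R]_m) (c : R) (i : 'I_m) :
  integrable_cV P X -> (forall w, `|H *m X w + g| <= c) ->
  `|(H *m expectation_cV P X + g) i 0| <= c.
Proof.
move=> X_int grad_le.
have [lin_int lin_eq] := Rintegral_lin_comb (H i) X_int.
have g_int : P.-integrable setT (EFin \o (fun=> g i 0)).
  exact/finite_measure_integrable_cst.
have -> : (H *m expectation_cV P X + g) i 0 =
    \int[P]_w (\sum_j H i j * X w j 0 + g i 0).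
  rewrite RintegralD// Rintegral_cst// (congr1 fine (probability_setT P)) mulr1.
  rewrite lin_eq !mxE; congr (_ + _); apply: eq_bigr => j _.
  by rewrite mxE unlock.
apply: Rintegral_probability_le => [|w].
  by have := integrableD measurableT lin_int g_int.
have := mx_norm_ge_entry (H *m X w + g) i 0; rewrite !mxE => /le_trans.
exact.
Qed.

Theorem corollary3 (R : realType) (n : nat) (p : 'I_n -> nat)
  (H : 'M[R]_(\sum_i p i)) (g : 'cV[R]_(\sum_i p i))
  (H_psd : psdmx H)
  (solvable : exists xbar, minimizer (qobj H g) xbar)
  (H_diag : forall i, posdefmx (submxblock H i i))
  (d : measure_display) (T : measurableType d) (P : probability T R)
  (sigma : nat -> T -> 'S_n) (x0 : 'cV[R]_(\sum_i p i))
  (x : nat -> T -> 'cV[R]_(\sum_i p i))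
  (x_rpbcd : rpbcd P H g x0 sigma x) :
  (forall k, integrable_cV P (x k)) /\
  exists2 xstar, minimizer (qobj H g) xstar &
    (fun k => expectation_cV P (x k)) @ \oo --> xstar.
Proof.
case: x_rpbcd => sigma_meas _ _ x_init sweep.
have [K [r [r0 r1 path_le]]] := bcd_path_estimate x0 H_psd solvable H_diag.
have step_le k w : `|x k.+1 w - x k w| <= K * r ^+ k.
  by have [] := path_le _ _ (x_init w) (fun l => sweep l w) k.
have grad_le k w : `|H *m x k w + g| <= K * r ^+ k.
  by have [] := path_le _ _ (x_init w) (fun l => sweep l w) k.
have x_meas := discrete_rv_iterates H_psd H_diag sigma_meas x_init sweep.
have x_int k : integrable_cV P (x k).
  suff [M] : exists M, forall w, `|x k w| <= M.
    exact: discrete_rv_integrable.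
  elim: k => [|k [M x_le]]; first by exists `|x0| => w; rewrite x_init.
  exists (M + K * r ^+ k) => w; rewrite -(subrKC (x k w) (x k.+1 w)).
  by apply: le_trans (ler_normD _ _) _; rewrite lerD.
split=> //; set E := fun k => expectation_cV P (x k).
have E_cvg i : cvgn (fun k => E k i 0).
  apply: (cvg_geometric_increments r0 r1) => k.
  exact: expectation_cV_le (step_le k).
pose xstar := \col_i limn (fun k => E k i 0).
have E_xstar i : (fun k => E k i 0) @ \oo --> xstar i 0.
  by rewrite mxE; exact: E_cvg.
exists xstar; last by apply: cvg_mx_entry => i j; rewrite ord1.
apply/qobj_minimizerP => //; apply/matrixP => i j; rewrite ord1 [RHS]mxE.
have grad_cvg : (fun k => (H *m E k + g) i 0) @ \oo --> (H *m xstar + g) i 0.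
  rewrite !mxE; under eq_fun do rewrite !mxE.
  apply: cvgD; last exact: cvg_cst.
  apply: cvg_big => [|l _]; first exact: add_continuous.
  by apply: cvgM; [exact: cvg_cst|exact: E_xstar].
apply: (cvg_unique _ grad_cvg); first exact: Rhausdorff.
apply: norm_cvg0; apply: (squeeze_cvgr (f := cst 0) (h := geometric K r)).
- apply: nearW => k; rewrite normr_ge0 /=.
  exact: expectation_cV_affine_le (grad_le k).
- exact: cvg_cst.
- by apply: cvg_geometric; rewrite ger0_norm.
Qed.
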